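(* Up to automorphisms of $\Delta$, there are at least two $K_2$-quasiperfect dominating sets $S$ in $\Delta$ for which $\Gamma(S)$ contains three pairwise adjacent vertices of pairwise different types $1$, $2$ and $3$.
   Context: $\Delta$ denotes the triangular lattice graph: its vertex set is $\{(x_1,x_2,x_3)\in\mathbb{Z}^3 : x_1+x_2+x_3=0\}$, and two vertices are adjacent iff their difference is one of $\pm(1,-1,0),\pm(1,0,-1),\pm(0,1,-1)$. A vertex subset $S$ is a quasiperfect dominating set (QPDS) if every vertex not in $S$ is adjacent to either one or two vertices of $S$; it is a $K_2$-QPDS if every connected component of $\Delta[S]$ is a single edge. A component $\{u,v\}$ has type $i\in\{1,2,3\}$ if $u$ and $v$ share the $i$-th coordinate $x_i$. $\Gamma(S)$ is the graph whose vertices are the components of $\Delta[S]$, two components being adjacent iff their graph distance in $\Delta$ (minimum distance between a vertex of one and a vertex of the other) is $3$. ''At least two up to automorphisms'' means at least two such sets, no one of which is the image of another under an automorphism of $\Delta$. *)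

(* Defs.v *)
From mathcomp Require Import all_boot all_order all_algebra.
From mathcomp Require Import boolp classical_sets cardinality.

Set Implicit Arguments.
Unset Strict Implicit.
Unset Printing Implicit Defensive.

Import GRing.Theory.

Local Open Scope ring_scope.
Local Open Scope classical_set_scope.
Local Open Scope card_scope.

Definition vertex : Type := {x : 'rV[int]_3 | \sum_i x 0 i == 0}.

Definition coord (x : vertex) (i : 'I_3) : int := val x 0 i.

(* For i <> j the vectors e_i - e_j are exactly +-(1,-1,0), +-(1,0,-1) and
   +-(0,1,-1). *)
Definition adj : rel vertex := fun x y =>
  [exists i : 'I_3, exists j : 'I_3,
    (i != j) && (val x - val y == delta_mx 0 i - delta_mx 0 j)].

Definition automorphism (f : vertex -> vertex) : Prop :=
  bijective f /\ {mono f : x y / adj x y}.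

Definition qpds (S : set vertex) : Prop :=
  forall x, ~ S x ->
    ([set y | adj x y] `&` S #= `I_1) \/ ([set y | adj x y] `&` S #= `I_2).

Definition walk (n : nat) (x y : vertex) : Prop :=
  exists p : seq vertex, [/\ path adj x p, last x p = y & size p = n].

Definition connected_in (S : set vertex) (x y : vertex) : Prop :=
  exists p : seq vertex,
    [/\ path adj x p, last x p = y & forall z, z \in x :: p -> S z].

Definition component (S C : set vertex) : Prop :=
  exists2 x, S x & C = [set y | connected_in S x y].

Definition K2_qpds (S : set vertex) : Prop :=
  qpds S /\
  forall C, component S C -> exists u v, adj u v /\ C = [set u; v].

(* The types 1, 2, 3 are represented by the indices 0, 1, 2 of 'I_3. *)
Definition has_type (C : set vertex) (i : 'I_3) : Prop :=
  exists u v, [/\ adj u v, C = [set u; v] & coord u i = coord v i].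

Definition is_dist (x y : vertex) (n : nat) : Prop :=
  walk n x y /\ forall m, walk m x y -> (n <= m)%N.

Definition is_set_dist (C D : set vertex) (n : nat) : Prop :=
  (exists x y, [/\ C x, D y & is_dist x y n]) /\
  forall x y m, C x -> D y -> is_dist x y m -> (n <= m)%N.

Definition Gamma_adj (S C D : set vertex) : Prop :=
  [/\ component S C, component S D & is_set_dist C D 3].

Definition has_rainbow_triangle (S : set vertex) : Prop :=
  exists C : 'I_3 -> set vertex,
    (forall i, component S (C i) /\ has_type (C i) i) /\
    (forall i j, i != j -> Gamma_adj S (C i) (C j)).

Definition automorphic_image (S T : set vertex) : Prop :=
  exists2 f, automorphism f & T = f @` S.

(* Main.v *)
(* In the coordinates (x_1, x_2), the two sets are
     S = {x : x_1 + 6 x_2 mod 34 in {0, 1, 3, 9, 17, 19, 22, 25}},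
     T = {x : x_1 + 8 x_2 mod 35 in {0, 1, 5, 13, 18, 23, 26, 30}},
   found by a computer search.  Membership being periodic, the domination and
   matching conditions reduce to a check over the residues, and both sets
   contain the same three edges forming a rainbow triangle.  An automorphism
   preserves the existence of two nonadjacent members with two common
   neighbours; such a pair exists in T but not in S. *)
Require Import Defs.
From mathcomp Require Import all_boot all_order all_algebra.
From mathcomp Require Import boolp classical_sets cardinality.
From mathcomp Require Import zify.

Set Implicit Arguments.
Unset Strict Implicit.
Unset Printing Implicit Defensive.

Import GRing.Theory.

Local Open Scope ring_scope.
Local Open Scope classical_set_scope.
Local Open Scope card_scope.

(* [all_algebra] shadows [Defs.coord] with the [coord] of [vector]. *)
Local Notation coord := Defs.coord.

(** * Cardinality of duplicate-free lists *)

Lemma card_eq_uniq (T : eqType) (s : seq T) : uniq s -> [set` s] #= `I_(size s).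
Proof.
elim: s => [_|x s IHs /= /andP[xs us]].
  by rewrite set_nil II0; exact: card_eq00.
apply/eq_cardSP; exists x => /=; first exact: mem_head.
suff -> : [set` x :: s] `\ x = [set` s] by exact: IHs.
apply/seteqP; split=> y /=.
  by case; rewrite inE => /orP[/eqP ->|].
by move=> ys; rewrite inE ys orbT; split=> // yx; rewrite -yx ys in xs.
Qed.

(** * Planar coordinates $(x_1, x_2)$ on the lattice and its six steps *)

Definition point : Type := (int * int)%type.

Definition row_of_point (p : point) : 'rV[int]_3 :=
  \row_i [:: p.1; p.2; - (p.1 + p.2)]`_i.

Lemma sum_row_of_point p : \sum_i row_of_point p 0 i == 0.
Proof. by rewrite !big_ord_recl big_ord0 !mxE /=; apply/eqP; lia. Qed.

Definition vertex_of (p : point) : vertex :=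
  exist (fun x : 'rV[int]_3 => \sum_i x 0 i == 0) _ (sum_row_of_point p).

Definition point_of (x : vertex) : point := (coord x 0, coord x 1).

Lemma vertex_ofK : cancel vertex_of point_of.
Proof. by case=> a b; rewrite /point_of /coord !mxE. Qed.

Lemma coord_sum (x : vertex) : coord x 0 + coord x 1 + coord x 2%:R = 0.
Proof.
have /eqP := valP x; rewrite !big_ord_recl big_ord0 addr0 addrA.
move=> sum0; apply: etrans sum0.
by congr (_ + _ + _); congr (val x _ _); exact/val_inj.
Qed.

Lemma vertex_eq (x y : vertex) :
  coord x 0 = coord y 0 -> coord x 1 = coord y 1 -> x = y.
Proof.
move=> e0 e1; apply/val_inj/rowP => i.
have e2 : coord x 2%:R = coord y 2%:R.
  by have := coord_sum x; have := coord_sum y; lia.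
case: i => [[|[|[|//]]] lti].
- by rewrite (_ : Ordinal lti = 0) //; apply/val_inj.
- by rewrite (_ : Ordinal lti = 1) //; apply/val_inj.
by rewrite (_ : Ordinal lti = 2%:R) //; apply/val_inj.
Qed.

Lemma point_ofK : cancel point_of vertex_of.
Proof. by move=> x; apply: vertex_eq; rewrite /coord !mxE. Qed.

Definition steps : seq point :=
  [:: (1, 0); (-1, 0); (0, 1); (0, -1); (1, -1); (-1, 1)].

(** The six steps are the vectors $e_j - e_i$ with the third coordinate dropped; the zero sum
    recovers it. *)
Lemma adjE x y : adj x y = (point_of y - point_of x \in steps).
Proof.
apply/existsP/idP => [[i /existsP[j /andP[ij /eqP eij]]]|].
  have e0 := congr1 (fun M : 'rV__ => M 0 0) eij.
  have e1 := congr1 (fun M : 'rV__ => M 0 1) eij.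
  move: e0 e1; rewrite !mxE !eqxx /= -!/(coord _ _) => e0 e1.
  (* [adj] constrains $x - y$, whereas steps go from $x$ to $y$, so the roles of [i] and [j] are
     exchanged. *)
  have -> : point_of y - point_of x =
      ((0 == j)%:R - (0 == i)%:R, (1 == j)%:R - (1 == i)%:R).
    by congr (_, _); rewrite /= -opprB ?e0 ?e1 opprB.
  by case: i j ij {eij e0 e1} => [[|[|[|//]]] ?] [[|[|[|//]]] ?].
have sx := coord_sum x; have sy := coord_sum y.
suff H (i j : 'I_3) : i != j ->
    point_of y - point_of x =
      ((0 == j)%:R - (0 == i)%:R, (1 == j)%:R - (1 == i)%:R) ->
    exists i, [exists j : 'I_3,
      (i != j) && (val x - val y == delta_mx 0 i - delta_mx 0 j)].
  rewrite !inE => /or4P[/eqP|/eqP|/eqP|/or3P[]/eqP] e.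
  - exact: (H 2%:R 0).
  - exact: (H 0 2%:R).
  - exact: (H 2%:R 1).
  - exact: (H 1 2%:R).
  - exact: (H 1 0).
  - exact: (H 0 1).
move=> ij [e0 e1]; exists i; apply/existsP; exists j; rewrite ij /=.
apply/eqP/rowP => k; rewrite !mxE eqxx /= -!/(coord _ _).
case: k => [[|[|[|//]]] ltk].
- by rewrite (_ : Ordinal ltk = 0); [rewrite -opprB e0 opprB|exact/val_inj].
- by rewrite (_ : Ordinal ltk = 1); [rewrite -opprB e1 opprB|exact/val_inj].
rewrite (_ : Ordinal ltk = 2%:R); last exact/val_inj.
(* Both sides equal 1, as an index takes exactly one of the three values; with the zero sums this
   gives the third coordinate. *)
suff : (0 == i)%:R + (1 == i)%:R + (2%:R == i)%:R =
       (0 == j)%:R + (1 == j)%:R + (2%:R == j)%:R :> int.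
  move: e0 e1 sx sy; rewrite /=.
  move: ((0 == i)%:R : int) ((1 == i)%:R : int) ((2%:R == i)%:R : int).
  move: ((0 == j)%:R : int) ((1 == j)%:R : int) ((2%:R == j)%:R : int).
  by move=> *; lia.
by case: i j {ij e0 e1} => [[|[|[|//]]] ?] [[|[|[|//]]] ?].
Qed.

Lemma adj_sym x y : adj x y = adj y x.
Proof.
rewrite !adjE -opprB; move: (point_of x - point_of y) => d.
have N (e : point) : e \in steps -> - e \in steps.
  by rewrite !inE => /or4P[|||/or3P[]] /eqP ->.
by apply/idP/idP => /N; rewrite ?opprK.
Qed.

Definition neighbours (x : vertex) : seq vertex :=
  [seq vertex_of (point_of x + d) | d <- steps].

Lemma mem_neighbours x y : (y \in neighbours x) = adj x y.
Proof.
rewrite adjE; apply/mapP/idP => [[d ds ->]|xy].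
  by rewrite vertex_ofK addrAC subrr add0r.
by exists (point_of y - point_of x); rewrite // subrKC point_ofK.
Qed.

Lemma uniq_neighbours x : uniq (neighbours x).
Proof.
rewrite map_inj_in_uniq // => d e _ _ /(can_inj vertex_ofK).
exact: addrI.
Qed.

(** Turns the cardinalities in [qpds] into a computable count over six neighbours. *)
Lemma card_adjI (x : vertex) (S : pred vertex) :
  [set y | adj x y] `&` [set` S] #= `I_(count S (neighbours x)).
Proof.
rewrite -size_filter.
move: (neighbours x) (uniq_neighbours x) (mem_neighbours x) => s us mems.
have -> : [set y | adj x y] `&` [set` S] = [set` [seq y <- s | S y]].
  apply/seteqP; split=> y /=; rewrite mem_filter mems.
    by case=> -> Sy; rewrite andbT.
  by case/andP.
exact/card_eq_uniq/filter_uniq.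
Qed.

(** * Components of a perfect matching *)

(* [Delta[S]] is a perfect matching. *)
Definition matched (S : set vertex) : Prop :=
  forall x, S x -> exists y, [/\ adj x y, S y &
    forall z, S z -> adj x z -> z = y].

(** A path inside [S] from [x] can only alternate between [x] and [y], each being the other's sole
    neighbour in [S]. *)
Lemma connected_in_matched (S : set vertex) x y : matched S ->
  S x -> S y -> adj x y -> [set z | connected_in S x z] = [set x; y].
Proof.
move=> mS Sx Sy xy.
have nxt u v w : S u -> S v -> S w -> adj u v -> adj u w -> w = v.
  move=> Su Sv Sw uv uw; have [t [_ _ h]] := mS _ Su.
  by rewrite (h w) // (h v).
apply/seteqP; split=> z /=; last first.
  case=> ->; [exists [::]|exists [:: y]]; split=> //=.
  - by move=> w; rewrite inE => /eqP ->.
  - by rewrite xy.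
  by move=> w; rewrite !inE => /orP[] /eqP ->.
case=> p [+ <- {z}].
(* The starting vertex is generalised to either end of the edge, so that induction on the path goes
   through. *)
suff : forall u, u = x \/ u = y -> path adj u p ->
    (forall z, z \in u :: p -> S z) -> last u p = x \/ last u p = y.
  by move=> h; apply: h; left.
elim: p => [//|v p IHp] u uxy /= /andP[uv pv] Sp.
apply: IHp => // [|w wp]; last by apply: Sp; rewrite inE wp orbT.
have Sv : S v by apply: Sp; rewrite !inE eqxx orbT.
case: uxy uv => -> uv; [right|left].
  exact: nxt uv.
by apply: nxt uv => //; rewrite adj_sym.
Qed.

Lemma component_matched (S : set vertex) x y : matched S ->
  S x -> S y -> adj x y -> component S [set x; y].
Proof.
by move=> mS Sx Sy xy; exists x => //; rewrite (connected_in_matched mS Sx Sy).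
Qed.

Lemma K2_qpds_matched (S : set vertex) : qpds S -> matched S -> K2_qpds S.
Proof.
move=> qS mS; split=> // _ [x Sx ->].
have [y [xy Sy _]] := mS x Sx.
by exists x, y; split=> //; exact: connected_in_matched.
Qed.

(** * Graph distance between edges *)

(* The graph distance of the triangular lattice from the origin. *)
Definition hexnorm (d : point) : nat :=
  maxn `|d.1| (maxn `|d.2| `|d.1 + d.2|).

Lemma hexnormD (d e : point) : (hexnorm (d + e)%R <= hexnorm d + hexnorm e)%N.
Proof.
have absD m n (a b : int) :
    (`|a| <= m -> `|b| <= n -> `|(a + b)%R| <= m + n)%N by lia.
move: (leqnn (hexnorm d)) (leqnn (hexnorm e)); rewrite {1 3}/hexnorm !geq_max.
move: (hexnorm d) (hexnorm e) => m n /and3P[d1 d2 d12] /and3P[e1 e2 e12].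
by rewrite /= addrACA !absD.
Qed.

Lemma hexnorm_steps d : d \in steps -> hexnorm d = 1%N.
Proof. by rewrite !inE => /or4P[|||/or3P[]] /eqP ->. Qed.

(** Steps have norm 1, so subadditivity bounds the length of a walk from below. *)
Lemma hexnorm_walk n x y :
  walk n x y -> (hexnorm (point_of y - point_of x)%R <= n)%N.
Proof.
case=> p [+ <- <-] {y n}; elim: p x => [|y p IHp] x /= => [_|/andP[xy yp]].
  by rewrite subrr.
rewrite -(subrKA (point_of y)) addrC (leq_trans (hexnormD _ _)) //.
by rewrite -add1n leq_add ?IHp // hexnorm_steps // -adjE.
Qed.

Definition sumset (s t : seq point) : seq point := [seq d + e | d <- s, e <- t].

Lemma walk3 x y :
  point_of y - point_of x \in sumset steps (sumset steps steps) -> walk 3 x y.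
Proof.
case/allpairsP=> [[a _]] /= [aS /allpairsP[[b c] /= [bS cS ->]] e].
exists [:: vertex_of (point_of x + a); vertex_of (point_of x + a + b); y].
split=> //=; rewrite !adjE !vertex_ofK andbT.
rewrite [point_of x + a - _]addrAC subrr add0r aS.
rewrite [_ + b - _]addrAC subrr add0r bS /=.
by rewrite -[_ + a + b]addrA opprD addrA e addrA addrC addKr.
Qed.

(** The lower bound is tested on all four pairs of ends, while a single pair joined by three steps
    suffices for attainment. *)
Definition at_distance3 (e f : point * point) : bool :=
  let ds := [seq q - p | p <- [:: e.1; e.2], q <- [:: f.1; f.2]] in
  all (fun d => (3 <= hexnorm d)%N) ds &&
  has (fun d => d \in sumset steps (sumset steps steps)) ds.

Definition edge_set (e : point * point) : set vertex :=
  [set vertex_of e.1; vertex_of e.2].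

Lemma edge_setP e x : edge_set e x <-> point_of x \in [:: e.1; e.2].
Proof.
rewrite !inE; split=> [[] ->|/orP[] /eqP e1]; rewrite ?vertex_ofK ?eqxx ?orbT //.
  by left; rewrite -e1 point_ofK.
by right; rewrite -e1 point_ofK.
Qed.

Lemma is_set_dist3 e f :
  at_distance3 e f -> is_set_dist (edge_set e) (edge_set f) 3.
Proof.
case/andP=> /allP far /hasP[_ /allpairsP[[p q] /= [pe qf ->]] d3].
have lb x y n : edge_set e x -> edge_set f y -> walk n x y -> (3 <= n)%N.
  move=> /edge_setP xe /edge_setP yf /hexnorm_walk; apply: leq_trans.
  by apply: far; apply/allpairsP; exists (point_of x, point_of y).
have ep : edge_set e (vertex_of p) by apply/edge_setP; rewrite vertex_ofK.
have fq : edge_set f (vertex_of q) by apply/edge_setP; rewrite vertex_ofK.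
split=> [|x y n ex fy [wn _]]; last exact: lb wn.
exists (vertex_of p), (vertex_of q); split=> //; split=> [|m]; last exact: lb.
by apply: walk3; rewrite !vertex_ofK.
Qed.

(** * The rainbow triangle shared by both sets *)

(** The edges have constant $x_1 = -3$, $x_2 = 0$ and $x_3 = -2$ respectively, hence types 1, 2 and
    3. *)
Definition rainbow_edge (i : 'I_3) : point * point :=
  nth (0, 0) [:: ((-3, 1), (-3, 2)); ((0, 0), (1, 0)); ((-1, 3), (-2, 4))] i.

Lemma rainbow_triangle (S : set vertex) : matched S ->
  (forall i, edge_set (rainbow_edge i) `<=` S) -> has_rainbow_triangle S.
Proof.
move=> mS sub; exists (fun i => edge_set (rainbow_edge i)).
have adj_edge i : adj (vertex_of (rainbow_edge i).1) (vertex_of (rainbow_edge i).2).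
  by rewrite adjE !vertex_ofK; case: i => [[|[|[|//]]] ?].
have comp i : component S (edge_set (rainbow_edge i)).
  by apply: component_matched => //; apply: (sub i); [left|right].
split=> [i|i j ij]; split=> //.
- exists (vertex_of (rainbow_edge i).1), (vertex_of (rainbow_edge i).2).
  by split=> //; rewrite /coord !mxE; case: i => [[|[|[|//]]] ?].
apply: is_set_dist3.
by case: i j ij => [[|[|[|//]]] ?] [[|[|[|//]]] ?]; vm_compute.
Qed.

(** * The invariant separating the two sets *)

(** Vertices at distance 2 have one common neighbour when they lie on a lattice line and two
    otherwise; this is the second case, phrased by adjacency and equality alone. *)
Definition skew_pair (S : set vertex) : Prop :=
  exists y z u v, [/\ S y /\ S z, y <> z /\ ~~ adj y z, u <> v,
    adj y u /\ adj y v & adj u z /\ adj v z].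

Lemma skew_pair_image f (S : set vertex) :
  automorphism f -> skew_pair (f @` S) <-> skew_pair S.
Proof.
case=> bf mf; have [g fK gK] := bf; split=> [|].
  case=> _ [_ [u [v [[[y Sy <-] [z Sz <-]] [yz nyz] uv ayuv auvz]]]].
  (* The common neighbours need not lie in the image of [S]; surjectivity of [f] pulls them back. *)
  move: nyz ayuv auvz; rewrite -[u]gK -[v]gK !mf => nyz ayuv auvz.
  exists y, z, (g u), (g v); split=> //.
  - by split=> // eyz; apply: yz; rewrite eyz.
  - by move=> /(can_inj gK).
case=> y [z [u [v [[Sy Sz] [yz nyz] uv ayuv auvz]]]].
exists (f y), (f z), (f u), (f v); rewrite !mf; split=> //.
- by split=> // /(can_inj fK)/yz.
- by move=> /(can_inj fK)/uv.
Qed.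

(** * Periodic sets and their finite verification *)

Definition periodic_pred (N : nat) (t : int) (A : seq nat) (p : point) : bool :=
  `|((p.1 + t * p.2) %% N)%Z|%N \in A.

Definition periodic_set (N : nat) (t : int) (A : seq nat) : set vertex :=
  [set` (fun x => periodic_pred N t A (point_of x))].

Lemma periodic_setE N t A p :
  periodic_set N t A (vertex_of p) = periodic_pred N t A p.
Proof. by rewrite -[in RHS](vertex_ofK p). Qed.

Section PeriodicSet.

Variables (N : nat) (t : int) (A : seq nat).
Hypothesis N_gt0 : (0 < N)%N.

Let P := periodic_pred N t A.
Let S := periodic_set N t A.

(** The linear form is additive and sends $(r, 0)$ to $r$, so the surroundings of [p] look like
    those of $(r, 0)$ for its residue $r$. *)
Lemma periodic_pred_residue p :
  exists2 r, r \in iota 0 N & forall d, P (p + d) = P ((r%:Z, 0) + d).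
Proof.
set r := ((p.1 + t * p.2) %% N)%Z; have r_ge0 : 0 <= r by rewrite /r; lia.
exists `|r|%N => [|d]; first by rewrite mem_iota /r; lia.
have Dp : (p + d).1 + t * (p + d).2 = p.1 + t * p.2 + (d.1 + t * d.2).
  by rewrite /= mulrDr addrACA.
have Dr : ((`|r|%N%:Z, 0) + d).1 + t * ((`|r|%N%:Z, 0) + d).2 =
    r + (d.1 + t * d.2).
  by rewrite /= add0r gez0_abs // addrA.
by rewrite /P /periodic_pred Dp Dr modzDml.
Qed.

(** A condition on the set as seen from a point meets at most [N] different patterns. *)
Lemma periodic_check (C : pred (pred point)) :
  all (fun r : nat => C (fun d => P ((r%:Z, 0) + d))) (iota 0 N) ->
  forall p, C (fun d => P (p + d)).
Proof.
move=> /allP allC p; have [r rN /funext ->] := periodic_pred_residue p.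
exact: allC.
Qed.

(* [f] is the indicator of the set, with the point under test as origin. *)
Definition locally_dominating (f : pred point) : bool :=
  let k := count f steps in if f 0 then k == 1 else (k == 1) || (k == 2).

(** Here $d + e$ is a second member reached through the neighbour $d$, and $d'$ a competing common
    neighbour. *)
Definition locally_skew_free (f : pred point) : bool :=
  if f 0 then all (fun d => all (fun e =>
    if f (d + e) then
      [|| d + e == 0, d + e \in steps |
       all (fun d' => if d + e - d' \in steps then d' == d else true) steps]
    else true) steps) steps
  else true.

Hypothesis dominating : forall p, locally_dominating (fun d => P (p + d)).

Lemma count_neighbours x :
  count (fun y => P (point_of y)) (neighbours x) =
  count (fun d => P (point_of x + d)) steps.
Proof. by rewrite count_map; apply: eq_count => d /=; rewrite vertex_ofK. Qed.

Lemma periodic_set_qpds : qpds S.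
Proof.
move=> x Sx; have := dominating (point_of x).
have := card_adjI x (fun y => P (point_of y)); rewrite count_neighbours.
rewrite /locally_dominating addr0 [P _](introF idP Sx) => cardSx.
by case/orP=> /eqP k; rewrite k in cardSx; [left|right].
Qed.

(** For a member, local domination requires a count of exactly 1, so filtering its neighbours leaves
    a singleton: its partner. *)
Lemma periodic_set_matched : matched S.
Proof.
move=> x Sx; have := dominating (point_of x).
rewrite /locally_dominating addr0 [P _]Sx -count_neighbours -size_filter.
case E : [seq _ <- _ | _] => [|y []] // _.
have mem z : (z == y) = P (point_of z) && adj x z.
  have := mem_filter (fun y => P (point_of y)) z (neighbours x).
  by rewrite E inE mem_neighbours.
have /andP[Sy xy] : P (point_of y) && adj x y by rewrite -mem.
by exists y; split=> // z Sz xz; apply/eqP; rewrite mem xz andbT.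
Qed.

Lemma periodic_set_skew_free :
  (forall p, locally_skew_free (fun d => P (p + d))) -> ~ skew_pair S.
Proof.
move=> free [y [z [u [v [[Sy Sz] [yz nyz] uv [yu yv] [uz vz]]]]]].
have := free (point_of y); rewrite /locally_skew_free addr0 [P _]Sy.
move: yu yv uz vz nyz; rewrite !adjE.
(* Relative to [y], the vertices [u], [v], [z] sit at $d$, $d'$, $d + e$, so $d + e - d'$ is the
   step from [v] to [z]. *)
set d := point_of u - _; set d' := point_of v - _; set e := point_of z - point_of u.
move=> ds d's es vz nyz /allP/(_ _ ds)/allP/(_ _ es).
have de : d + e = point_of z - point_of y by rewrite addrC addrA subrK.
have Pde : P (point_of y + (d + e)) by rewrite de addrC subrK.
have /negbTE de0 : d + e != 0.
  by rewrite de subr_eq0 (inj_eq (can_inj point_ofK)); apply/eqP/nesym.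
have /negbTE nde : d + e \notin steps by rewrite de.
have ded' : d + e - d' \in steps by rewrite de opprB addrA subrK.
rewrite Pde de0 nde !orFb => /allP/(_ _ d's).
rewrite ded' => /eqP/addIr.
by move=> /(can_inj point_ofK)/nesym.
Qed.

End PeriodicSet.

Lemma periodic_set_rainbow N t A :
  (0 < N)%N ->
  all (fun r : nat => locally_dominating
         (fun d => periodic_pred N t A ((r%:Z, 0) + d))) (iota 0 N) ->
  all (periodic_pred N t A)
    [:: (-3, 1); (-3, 2); (0, 0); (1, 0); (-1, 3); (-2, 4)] ->
  K2_qpds (periodic_set N t A) /\ has_rainbow_triangle (periodic_set N t A).
Proof.
move=> N_gt0 /(periodic_check N_gt0) dom /allP sub.
split; first exact: K2_qpds_matched (periodic_set_qpds dom) (periodic_set_matched dom).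
apply: rainbow_triangle (periodic_set_matched dom) _ => i x /edge_setP xi.
apply: sub; move: xi; rewrite !inE.
by case: i => [[|[|[|//]]] ?] /orP[] /eqP ->.
Qed.

Theorem theorem13 :
  exists S T : set vertex,
    [/\ K2_qpds S /\ has_rainbow_triangle S,
        K2_qpds T /\ has_rainbow_triangle T,
        ~ automorphic_image S T &
        ~ automorphic_image T S].
Proof.
pose A34 := [:: 0; 1; 3; 9; 17; 19; 22; 25]%N.
pose A35 := [:: 0; 1; 5; 13; 18; 23; 26; 30]%N.
pose S := periodic_set 34 6 A34; pose T := periodic_set 35 8 A35.
have nskewS : ~ skew_pair S.
  apply: periodic_set_skew_free.
  by apply: (@periodic_check 34 6 A34 _ locally_skew_free); last by vm_compute.
have skewT : skew_pair T.
  (* The residues are 1 and $3 - 8 = -5$, which is 30 modulo 35. The difference $(2, -1)$ is $(1, 0)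
     + (1, -1)$; the two orders of these steps give the common neighbours. *)
  exists (vertex_of (1, 0)), (vertex_of (3, -1)).
  exists (vertex_of (2, 0)), (vertex_of (2, -1)).
  rewrite !adjE !vertex_ofK; split=> //.
  - by split; rewrite /T periodic_setE; vm_compute.
  - by split=> // /(can_inj vertex_ofK).
  - by move=> /(can_inj vertex_ofK).
exists S, T; split.
- by apply: periodic_set_rainbow; [|vm_compute|vm_compute].
- by apply: periodic_set_rainbow; [|vm_compute|vm_compute].
(* The invariant is pulled back along [f] here, and pushed forward in the other direction. *)
- by case=> f af TE; apply/nskewS/(skew_pair_image S af); rewrite -TE.
- by case=> f af SE; apply: nskewS; rewrite SE; apply/skew_pair_image.
Qed.
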